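(* Let $\mathbb{F}$ be a finite field, let $1\le k\le n$, and let $G$ be a polynomial generating matrix, i.e. a $k\times n$ matrix of rank $k$ with entries in $\mathbb{F}[D]$. Then $$\operatorname{intdeg} G\le \operatorname{Mcdeg} G .$$ If moreover $G$ is reduced, then $$\operatorname{intdeg} G=\operatorname{Mcdeg} G=\operatorname{extdeg} G .$$
   Context: Vectors are row vectors. $\mathbb{F}((D))$ denotes the field of formal Laurent series over $\mathbb{F}$ in $D$ (finitely many negative powers). **Degrees of a polynomial matrix.** Let $G$ be a $k\times n$ matrix over $\mathbb{F}[D]$ of rank $k$ with rows $g_1,\dots,g_k$, where $g_i=(g_i^{(1)},\dots,g_i^{(n)})$. - The degree of the $i$-th row is $\deg g_i=\max_j\deg g_i^{(j)}$. - The external degree is $\operatorname{extdeg}G=\sum_{i=1}^k\deg g_i$. - The internal degree $\operatorname{intdeg}G$ is the largest degree of a $k\times k$ minor of $G$. - $G$ is *reduced* if its external degree cannot be lowered by adding polynomial multiples of some rows to another row. Equivalently, $\operatorname{extdeg}G\le\operatorname{extdeg}(TG)$ for every unimodular $k\times k$ matrix $T$, where unimodular means polynomial with nonzero determinant in $\mathbb{F}$. **Encoders and McMillan degree.** An *encoder* with $k$ inputs and $n$ outputs and of degree $m$ has state space $\mathbb{F}^m$ and is given by matrices $\mathcal A\in\mathbb{F}^{m\times m}$, $\mathcal B\in\mathbb{F}^{k\times m}$, $\mathcal C\in\mathbb{F}^{m\times n}$, $\mathcal D\in\mathbb{F}^{k\times n}$. In state $s$ and with input $\vec u\in\mathbb{F}^k$,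 it outputs $\vec v=s\,\mathcal C+\vec u\,\mathcal D$ and moves to state $s'=s\,\mathcal A+\vec u\,\mathcal B$. It *realizes* (the encoding given by) $G$ if, for every input sequence $u=\sum_{t\ge z}u_tD^t\in\mathbb{F}((D))^k$, the encoder, being in state $0$ before the input starts, produces the output sequence $uG\in\mathbb{F}((D))^n$. The *McMillan degree* $\operatorname{Mcdeg}G$ is the smallest degree $m$ among all encoders realizing $G$. *)

(* Defs.v *)
From mathcomp Require Import all_boot all_order all_algebra.
From mathcomp Require Import boolp.
Set Implicit Arguments.
Unset Strict Implicit.
Unset Printing Implicit Defensive.
Import Order.TTheory GRing.Theory Num.Theory.
Local Open Scope ring_scope.

Section Degrees.
Variables (F : fieldType) (k n : nat).
Implicit Type G : 'M[{poly F}]_(k, n).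

(* The rank of G, taken over the field of fractions F(D). *)
Definition poly_mxrank G : nat :=
  \rank (map_mx (@FracField.tofrac {poly F}) G).

(* Degrees are natural numbers, [(size p).-1] for a polynomial p, so that the
   zero polynomial gets degree 0 instead of -oo.  If G has rank k, then no row
   of G, or of a matrix obtained from G by row operations, vanishes, and some
   k x k minor of G is nonzero; the maxima below are then the usual ones. *)
Definition rowdeg G (i : 'I_k) : nat := (\max_(j < n) (size (G i j)).-1)%N.

Definition extdeg G : nat := (\sum_(i < k) rowdeg G i)%N.

(* A minor is given by the increasing sequence f of its k columns. *)
Definition intdeg G : nat :=
  (\max_(f : {ffun 'I_k -> 'I_n} |
          [forall i : 'I_k, forall j : 'I_k, (i < j) ==> (f i < f j)])
     (size (\det (colsub f G))).-1)%N.

Definition add_rows (i : 'I_k) (p : 'I_k -> {poly F}) G :=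
  \matrix_(i' < k, j < n)
    (G i' j + (if i' == i then \sum_(h < k | h != i) p h * G h j else 0)).

Definition reduced G : Prop :=
  forall (i : 'I_k) (p : 'I_k -> {poly F}),
    (extdeg G <= extdeg (add_rows i p G))%N.

End Degrees.

Section Encoders.
Variable F : fieldType.

(* A series \sum_t a_t D^t is given by its coefficient function a : int -> F,
   and a vector of k series by a function u : int -> 'rV[F]_k.  It lies in
   F((D)), resp. F((D))^k, when it vanishes to the left of some z. *)
Definition vanishes_before k (z : int) (u : int -> 'rV[F]_k) : Prop :=
  forall t : int, t < z -> u t = 0.

(* The coefficient at D^t of the product of a series and a polynomial. *)
Definition series_mul_poly (a : int -> F) (p : {poly F}) (t : int) : F :=
  \sum_(l < size p) a (t - (l : nat)%:Z) * p`_l.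

Definition series_mulmx k n (u : int -> 'rV[F]_k) (G : 'M[{poly F}]_(k, n))
    (t : int) : 'rV[F]_n :=
  \row_(j < n) \sum_(i < k) series_mul_poly (fun t' => u t' 0 i) (G i j) t.

Record encoder (k n m : nat) := Encoder {
  encA : 'M[F]_m;
  encB : 'M[F]_(k, m);
  encC : 'M[F]_(m, n);
  encD : 'M[F]_(k, n)
}.

Section Run.
Variables (k n m : nat) (E : encoder k n m).

Definition enc_next (s : 'rV[F]_m) (u : 'rV[F]_k) : 'rV[F]_m :=
  s *m encA E + u *m encB E.

Definition enc_out (s : 'rV[F]_m) (u : 'rV[F]_k) : 'rV[F]_n :=
  s *m encC E + u *m encD E.

(* The state at time z + d, when the state at time z is 0. *)
Fixpoint enc_state_after (u : int -> 'rV[F]_k) (z : int) (d : nat) : 'rV[F]_m :=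
  if d is d'.+1 then enc_next (enc_state_after u z d') (u (z + d'%:Z)) else 0.

(* The state at time t; it is 0 up to time z, when the input starts. *)
Definition enc_state (u : int -> 'rV[F]_k) (z t : int) : 'rV[F]_m :=
  if t - z is Posz d then enc_state_after u z d else 0.

Definition enc_output (u : int -> 'rV[F]_k) (z t : int) : 'rV[F]_n :=
  enc_out (enc_state u z t) (u t).

Definition realizes (G : 'M[{poly F}]_(k, n)) : Prop :=
  forall (z : int) (u : int -> 'rV[F]_k), vanishes_before z u ->
    forall t : int, enc_output u z t = series_mulmx u G t.

End Run.

Section Realizability.
Variables (k n : nat) (G : 'M[{poly F}]_(k, n)).

(* A shift register remembering the last d inputs, d bounding all degrees. *)
Let d : nat := (\max_(i < k) \max_(j < n) size (G i j))%N.

Let shift : 'M[F]_d := \matrix_(a, b) (a == b.+1 :> nat)%:R.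
Let top : 'cV[F]_d := \matrix_(a, _) (a == 0 :> nat)%:R.
Let E : encoder k n (d * k) :=
  Encoder (lin_mulmx shift) (lin1_mx (mxvec \o mulmx top))
    (\sum_(l < d)
       lin1_mx (mulmxr (map_mx (coefp l.+1) G) \o (row l \o vec_mx)))
    (map_mx (coefp 0) G).

Fact shift_register_state (u : int -> 'rV[F]_k) (z : int) (m : nat) :
    vanishes_before z u ->
  enc_state_after E u z m =
  mxvec (\matrix_(l < d, i < k) u (z + m%:Z - (l : nat).+1%:Z) 0 i).
Proof.
move=> u0; elim: m => [|m IHm] /=.
  apply/esym/eqP; rewrite mxvec_eq0; apply/eqP/matrixP=> l i; rewrite !mxE u0 ?mxE //.
  by rewrite addr0 gtrBl.
rewrite /enc_next IHm /= mul_vec_lin mul_rV_lin1 /= -linearD; congr mxvec.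
apply/matrixP=> l i; rewrite !mxE [X in _ + X]big_ord1 !mxE.
under eq_bigr do rewrite !mxE mulr_natl mulrb.
have -> : z + m.+1%:Z - (l : nat).+1%:Z = z + m%:Z - (l : nat)%:Z.
  by rewrite !intS opprD addrA addrCA [1 + _]addrC addrK.
case: l => [[|l] lt_l] /=.
  by rewrite big1 // add0r subr0 mul1r.
have lt'l : (l < d)%N by apply: ltnW.
rewrite (bigD1 (Ordinal lt'l)) //= eqxx mul0r big1 ?addr0 // => a.
by rewrite -val_eqE /= eqSS eq_sym => /negbTE->.
Qed.

Fact encoder_exists : exists m, `[< exists E : encoder k n m, realizes E G >].
Proof.
exists (d * k)%N; apply/asboolP; exists E => z u u0 t.
rewrite /enc_output /enc_out /=.
have -> : enc_state E u z t =
    mxvec (\matrix_(l < d, i < k) u (t - (l : nat).+1%:Z) 0 i).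
  rewrite /enc_state; case Dt: (t - z) => [m|m].
    by rewrite shift_register_state // -Dt addrC subrK.
  apply/esym/eqP; rewrite mxvec_eq0; apply/eqP/matrixP=> l i; rewrite !mxE u0 ?mxE //.
  have lt_tz : t < z by rewrite -subr_lt0 Dt.
  by apply: le_lt_trans lt_tz; rewrite gerBl.
rewrite mulmx_sumr; under eq_bigr do rewrite mul_rV_lin1 /= mxvecK.
apply/rowP=> j; rewrite !mxE summxE; under eq_bigr do rewrite mxE.
rewrite exchange_big -big_split; apply: eq_bigr => i _ /=.
rewrite !mxE /series_mul_poly.
have le_d : (size (G i j) <= d.+1)%N.
  by apply/leqW/(leq_trans _ (leq_bigmax i))/(leq_bigmax j).
rewrite (big_ord_widen _ (fun l => u (t - l%:Z) 0 i * (G i j)`_l) le_d).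
rewrite [RHS]big_mkcond [RHS]big_ord_recl /= addrC; congr (_ + _).
  case: posnP => [s0|]; last by rewrite subr0.
  by rewrite nth_default ?mulr0 ?s0.
apply: eq_bigr => l _; rewrite !mxE /=.
by case: ltnP => // le_l; rewrite [X in _ * X](nth_default _ le_l) mulr0.
Qed.

Definition Mcdeg : nat := ex_minn encoder_exists.

End Realizability.

End Encoders.

(* Main.v *)
Require Import Defs.
From mathcomp Require Import all_boot all_order all_algebra.
From mathcomp Require Import perm.
Set Implicit Arguments.
Unset Strict Implicit.
Unset Printing Implicit Defensive.
Import Order.TTheory GRing.Theory Num.Theory.
Local Open Scope ring_scope.

(* The proof is the chain extdeg G <= intdeg G <= Mcdeg G <= extdeg G, whose
   first inequality alone needs G to be reduced.
   - An encoder (A, B, C, D) of degree m realizing G has transfer function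
     G = D + X B (1 - X A)^-1 C.  By Schur's formula, det (1 - X A) times a minor
     of G is the determinant of a block matrix with m columns of degree at most 1
     and k constant columns, so it has degree at most m; and det (1 - X A) is
     nonzero, having constant term 1.
   - The i-th input fed into a shift register of length deg g_i gives an encoder
     of degree extdeg G.
   - If G is reduced, its matrix of leading row coefficients has rank k: a
     dependency c between them, multiplied by suitable powers of X, would lower
     the degree of a row g_i of maximal degree among those with c_i != 0.  A
     nonzero k x k minor of that matrix is the coefficient at X^(extdeg G) of
     the corresponding minor of G. *)

(** * Top coefficients of determinants, and nonzero minors *)

Section PolyMatrices.
Variable F : fieldType.

(** Both claims go through one induction: the size bound on the tail kills all but one term of the
    convolution giving the coefficient. *)
Lemma size_coef_prod (I : Type) (r : seq I) (p : I -> {poly F}) (d : I -> nat) :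
  (forall i, size (p i)%R <= (d i).+1)%N ->
  (size (\prod_(i <- r) p i)%R <= (\sum_(i <- r) d i).+1)%N /\
  (\prod_(i <- r) p i)`_(\sum_(i <- r) d i) = \prod_(i <- r) (p i)`_(d i).
Proof.
move=> le_pd; elim: r => [|i r [IHs IHc]].
  by rewrite !big_nil size_poly1 coefC.
rewrite !big_cons; split.
  apply: leq_trans (size_polyMleq _ _) _.
  by rewrite -subn1 leq_subLR add1n -addSn -addnS leq_add.
rewrite coefM (bigD1 (inord (d i))) //= inordK ?ltnS ?leq_addr // addKn IHc.
rewrite [X in _ + X]big1 ?addr0 // => j neq_j.
case: (ltngtP j (d i)) => [lt_j|gt_j|eq_j].
- rewrite [X in _ * X]nth_default ?mulr0 //; apply: leq_trans IHs _.
  by rewrite ltn_subRL ltn_add2r.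
- by rewrite nth_default ?mul0r //; apply: leq_trans (le_pd i) _.
- by case/eqP: neq_j; apply: val_inj; rewrite /= inordK ?ltnS ?leq_addr.
Qed.

Section RowDegrees.
Variables (k : nat) (M : 'M[{poly F}]_k) (d : 'I_k -> nat).
Hypothesis le_Md : forall i j, (size (M i j) <= (d i).+1)%N.

Lemma size_det_leq : (size (\det M) <= (\sum_i d i).+1)%N.
Proof.
rewrite /determinant; apply: (leq_trans (size_sum _ _ _)).
apply/bigmax_leqP => s _; rewrite size_Msign.
by have [] := size_coef_prod (index_enum _) (fun i => le_Md i (s i)).
Qed.

(** Each Leibniz term takes one entry from every row, so the exponent bound is the same for all
    permutations. *)
Lemma coef_det : (\det M)`_(\sum_i d i) = \det (\matrix_(i, j) (M i j)`_(d i)).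
Proof.
rewrite /determinant coef_sum; apply: eq_bigr => s _.
have [_ Es] := size_coef_prod (index_enum _) (fun i => le_Md i (s i)).
under [in RHS]eq_bigr do rewrite mxE.
by rewrite -Es; case: (s : bool); rewrite ?mulN1r ?mul1r ?coefN.
Qed.
End RowDegrees.

(** [fullrankfun] picks k independent columns in no prescribed order; enumerating its image sorts
    them, as [intdeg] requires. *)
Lemma exists_increasing_minor k n (A : 'M[F]_(k, n)) : row_free A ->
  exists2 f : {ffun 'I_k -> 'I_n},
    forall i j : 'I_k, (i < j)%N -> (f i < f j)%N & \det (colsub f A) != 0.
Proof.
rewrite -row_leq_rank -mxrank_tr => rkA.
have fullA : row_full A^T by rewrite /row_full eqn_leq rank_leq_col.
pose g := fullrankfun fullA; pose S := g @: [set: 'I_k].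
have cardS : #|S| = k by rewrite card_imset ?cardsT ?card_ord //; apply: fullrankfun_inj.
pose f := [ffun i : 'I_k => enum_val (cast_ord (esym cardS) i)].
exists f => [i j lt_ij|].
  have srt : sorted ltn (map val (enum S)).
    rewrite (subseq_sorted ltn_trans (s2 := iota 0 n)) ?iota_ltn_sorted //.
    by rewrite -val_enum_ord map_subseq // enumT filter_subseq.
  rewrite !ffunE !(enum_val_nth (g i)) -[X in (X < _)%N](nth_map _ 0%N val)
    -?[X in (_ < X)%N](nth_map _ 0%N val) -?cardE ?cardS ?ltn_ord //.
  by rewrite (sorted_ltn_nth ltn_trans) ?inE ?size_map -?cardE ?cardS ?ltn_ord.
have fullf : row_full (rowsub f A^T).
  rewrite -sub1mx (submx_trans _ (_ : (rowsub g A^T <= _)%MS)) //.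
    by rewrite sub1mx fullrowsub_full.
  apply/row_subP => i; rewrite row_rowsub.
  have gS : g i \in S by apply: imset_f; rewrite inE.
  have <- : f (cast_ord cardS (enum_rank_in gS (g i))) = g i.
    by rewrite ffunE cast_ordK enum_rankK_in.
  by rewrite -row_rowsub row_sub.
by rewrite -unitfE -unitmxE -unitmx_tr -row_full_unit trmx_mxsub.
Qed.

End PolyMatrices.

(** * Reduced matrices and leading row coefficients *)

Section Reduced.
Variables (F : fieldType) (k n : nat) (G : 'M[{poly F}]_(k, n)).

Definition lead_row_mx : 'M[F]_(k, n) := \matrix_(i, j) (G i j)`_(rowdeg G i).

Lemma size_rowdeg i j : (size (G i j) <= (rowdeg G i).+1)%N.
Proof. by apply: leq_trans (leqSpred _) _; rewrite ltnS (leq_bigmax j). Qed.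

Lemma full_rank_row_indep (c : 'rV[{poly F}]_k) :
  poly_mxrank G = k -> c *m G = 0 -> c = 0.
Proof.
move=> rkG cG0.
have freeG : row_free (map_mx (@FracField.tofrac {poly F}) G) by apply/eqP.
have /(row_free_inj freeG) c0 : map_mx (@FracField.tofrac {poly F}) c *m
    map_mx (@FracField.tofrac {poly F}) G = 0 *m map_mx (@FracField.tofrac {poly F}) G.
  by rewrite -map_mxM cG0 map_mx0 mul0mx.
apply/rowP => i; move/rowP/(_ i): c0; rewrite !mxE => /eqP.
by rewrite tofrac_eq0 => /eqP.
Qed.

Lemma reduced_lead_row_free :
  poly_mxrank G = k -> reduced G -> row_free lead_row_mx.
Proof.
move=> rkG redG; rewrite -kermx_eq0; apply/negPn/negP => /rowV0Pn[c /sub_kermxP cL0].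
case/rV0Pn => i0 ci0.
case: (@arg_maxnP _ i0 (fun i => c 0 i != 0) (rowdeg G) ci0) => i ci max_i {i0 ci0}.
have lead0 j : \sum_h c 0 h * (G h j)`_(rowdeg G h) = 0.
  by move/rowP/(_ j): cL0; rewrite !mxE => cLj; rewrite -[RHS]cLj;
     apply: eq_bigr => h _; rewrite mxE.
(* In degree 0 nothing can be lowered; but then every row with [c 0 h != 0] is constant, so [c] is a
   dependency of G itself, against the rank. *)
have [di0|di_gt0] := posnP (rowdeg G i).
  have /(full_rank_row_indep rkG)/rowP/(_ i) : map_mx polyC c *m G = 0.
    apply/rowP => j; rewrite !mxE -[RHS]polyC0 -(lead0 j) rmorph_sum.
    apply: eq_bigr => h _; rewrite !mxE rmorphM /=.
    have [->|ch] := eqVneq (c 0 h) 0; first by rewrite !mul0r.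
    have dh0 : rowdeg G h = 0%N by have := max_i h ch; rewrite /= di0 leqn0 => /eqP.
    by have := size_rowdeg h j; rewrite dh0 => /size1_polyC {1}->.
  by rewrite !mxE => /eqP; rewrite polyC_eq0 (negPf ci).
(* The new row i is [(c 0 i)^-1] times the sum of the rows c_h X^(d_i - d_h) g_h. The truncated
   subtraction is harmless: c_h = 0 when d_h > d_i. *)
pose p h := (c 0 h / c 0 i) *: 'X^(rowdeg G i - rowdeg G h).
have := redG i p; rewrite leqNgt => /negP; apply.
rewrite /extdeg (bigD1 i) //= [ltnRHS](bigD1 i) //= -addSn leq_add //; last first.
  apply: leq_sum => h /negPf neq_hi; apply: leq_trans (_ : rowdeg G h <= _)%N => //.
  by apply/bigmax_leqP => j _; rewrite mxE neq_hi addr0 (leq_bigmax j).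
rewrite -(ltn_predK di_gt0) ltnS; apply/bigmax_leqP => j _.
rewrite -subn1 leq_subLR add1n (ltn_predK di_gt0).
have -> : add_rows i p G i j =
    (c 0 i)^-1 *: \sum_h c 0 h *: ('X^(rowdeg G i - rowdeg G h) * G h j).
  rewrite mxE eqxx [in RHS](bigD1 i) //= subnn mul1r scalerDr scalerA mulVf // scale1r.
  rewrite scaler_sumr; congr (_ + _); apply: eq_bigr => h _.
  by rewrite scalerA -scalerAl mulrC.
apply: leq_trans (size_scale_leq _ _) _; apply/leq_sizeP => l le_l.
(* At d_i the coefficients cancel by the dependency [lead0]; beyond d_i each term vanishes by
   degree. *)
rewrite coef_sum; have [->|neq_l] := eqVneq l (rowdeg G i).
  rewrite -[RHS](lead0 j); apply: eq_bigr => h _; rewrite coefZ coefXnM.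
  have [->|ch] := eqVneq (c 0 h) 0; first by rewrite !mul0r.
  by have le_h : (rowdeg G h <= rowdeg G i)%N := max_i h ch; rewrite ltnNge leq_subr /= subKn.
rewrite big1 // => h _; rewrite coefZ coefXnM.
have [->|ch] := eqVneq (c 0 h) 0; first by rewrite !mul0r.
have le_h : (rowdeg G h <= rowdeg G i)%N := max_i h ch; case: ifP => _; rewrite ?mulr0 //.
rewrite nth_default ?mulr0 //; apply: leq_trans (size_rowdeg h j) _.
have lt_l : (rowdeg G i < l)%N by rewrite ltn_neqAle eq_sym neq_l.
by rewrite -[X in (X < _)%N](subKn le_h) ltn_sub2r // (leq_ltn_trans (leq_subr _ _)).
Qed.

Lemma reduced_extdeg_leq_intdeg :
  poly_mxrank G = k -> reduced G -> (extdeg G <= intdeg G)%N.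
Proof.
move=> rkG redG.
have [f incf det_f] := exists_increasing_minor (reduced_lead_row_free rkG redG).
have size_f i j : (size (colsub f G i j) <= (rowdeg G i).+1)%N.
  by rewrite mxE size_rowdeg.
apply: (bigop.bigmax_sup f).
  by apply/forallP => i; apply/forallP => j; apply/implyP/incf.
have := coef_det size_f; rewrite (_ : \matrix_(i, j) _ = colsub f lead_row_mx).
  move=> Edet; rewrite -ltnS (leq_trans _ (leqSpred _)) // ltnNge.
  by apply: contra det_f => le_s; rewrite -Edet nth_default.
by apply/matrixP => i j; rewrite !mxE.
Qed.

End Reduced.

(** * Realization by k shift registers *)

Section ControllerForm.
Variables (F : fieldType) (k n : nat) (G : 'M[{poly F}]_(k, n)).

Let T : finType := {i : 'I_k & 'I_(rowdeg G i)}.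
(* Cell (i, l) holds the value of the i-th input l + 1 time units ago. *)
Let cell (a : 'I_#|T|) : T := enum_val a.

Definition controller_form : encoder F k n #|T| :=
  Encoder
    (\matrix_(a, b) ((tag (cell a) == tag (cell b)) &&
       (tagged (cell b) == (tagged (cell a)).+1 :> nat))%:R)
    (\matrix_(i, a) ((tag (cell a) == i) && (tagged (cell a) == 0 :> nat))%:R)
    (\matrix_(a, j) (G (tag (cell a)) j)`_(tagged (cell a)).+1)
    (map_mx (coefp 0) G).

Lemma card_controller_states : #|T| = extdeg G.
Proof.
rewrite -sum1_card (eq_bigr (fun=> 1%N)) // /extdeg.
rewrite -(sig_big_dep predT (fun _ => predT) (fun i (l : 'I_(rowdeg G i)) => 1%N)) /=.
by apply: eq_bigr => i _; rewrite sum1_card card_ord.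
Qed.

Lemma controller_state (u : int -> 'rV[F]_k) (z : int) (m : nat) :
  vanishes_before z u ->
  enc_state_after controller_form u z m =
  \row_a u (z + m%:Z - (tagged (cell a) : nat).+1%:Z) 0 (tag (cell a)).
Proof.
move=> u0; elim: m => [|m IHm].
  by apply/rowP => a; rewrite !mxE u0 ?mxE // addr0 gtrBl.
rewrite /= /enc_next IHm /=; apply/rowP => b; rewrite !mxE.
have -> : z + m.+1%:Z - (tagged (cell b) : nat).+1%:Z =
    z + m%:Z - (tagged (cell b) : nat)%:Z.
  by rewrite !intS opprD addrA addrCA [1 + _]addrC addrK.
under eq_bigr do rewrite !mxE mulr_natr mulrb.
under [X in _ + X]eq_bigr do rewrite !mxE mulr_natr mulrb.
rewrite -!big_mkcond /=.
(* A cell at position 0 is fed by the input alone, a cell at position l + 1 only by its predecessor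
   [x]. *)
case Eb: (cell b) => [i [[|l] lt_l]] /=.
  rewrite big1 => [|a]; last by rewrite andbF.
  rewrite add0r (big_pred1 i) ?subr0 // => h; by rewrite andbT eq_sym.
rewrite [X in _ + X]big1 => [|h]; last by rewrite andbF.
pose x : T := Tagged (fun i => 'I_(rowdeg G i)) (Ordinal (ltnW lt_l)).
rewrite addr0 (big_pred1 (enum_rank x)) => [|a].
  by rewrite /cell enum_rankK.
rewrite /= -(inj_eq enum_val_inj) enum_rankK -/(cell a).
apply/andP/eqP => [|->] //=; case: (cell a) => h [m' lt_m'] /= [/eqP Eh].
rewrite eqSS => /eqP El; move: lt_m'; rewrite -El {El m'}; move: Eh => -> {h} lt_l'.
by rewrite /x; congr (Tagged _ _); apply: val_inj.
Qed.

Lemma controller_form_realizes : realizes controller_form G.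
Proof.
move=> z u u0 t; rewrite /enc_output /enc_out /=.
have -> : enc_state controller_form u z t =
    \row_a u (t - (tagged (cell a) : nat).+1%:Z) 0 (tag (cell a)).
  rewrite /enc_state; case Dt: (t - z) => [m|m].
    by rewrite controller_state // -Dt addrC subrK.
  apply/rowP => a; rewrite !mxE u0 ?mxE //.
  have lt_tz : t < z by rewrite -subr_lt0 Dt.
  by apply: le_lt_trans lt_tz; rewrite gerBl.
apply/rowP => j; rewrite !mxE.
under eq_bigr do rewrite !mxE.
pose H i (l : 'I_(rowdeg G i)) := u (t - (l : nat).+1%:Z) 0 i * (G i j)`_l.+1.
rewrite -(big_enum_val (A := T) (fun x : T => H (tag x) (tagged x))) /=.
rewrite -(sig_big_dep predT (fun _ => predT) H) -big_split /=.
apply: eq_bigr => i _; rewrite !mxE /series_mul_poly.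
have le_d := size_rowdeg G i j.
rewrite (big_ord_widen _ (fun l => u (t - l%:Z) 0 i * (G i j)`_l) le_d).
(* The constant coefficient comes from [encD], the higher ones from the register; for a zero entry
   the constant coefficient is 0 by default. *)
rewrite [RHS]big_mkcond [RHS]big_ord_recl /= addrC; congr (_ + _).
  case: posnP => [s0|]; last by rewrite subr0.
  by rewrite nth_default ?mulr0 ?s0.
apply: eq_bigr => l _; case: ltnP => // le_l.
by rewrite /H nth_default ?mulr0.
Qed.

Lemma Mcdeg_leq_extdeg : (Mcdeg G <= extdeg G)%N.
Proof.
rewrite /Mcdeg; case: ex_minnP => m _; apply; apply/boolp.asboolP.
by rewrite -card_controller_states; exists controller_form; apply: controller_form_realizes.
Qed.

End ControllerForm.

(** * Transfer function and the bound on minors *)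

Section Transfer.
Variables (F : fieldType) (k n m : nat) (E : encoder F k n m).
Variable G : 'M[{poly F}]_(k, n).
Hypothesis realE : realizes E G.

Let XA : 'M[{poly F}]_m := 1%:M - 'X *: map_mx polyC (encA E).
Let chi := \det XA.
Let B := map_mx polyC (encB E).
Let C := map_mx polyC (encC E).
Let D := map_mx polyC (encD E).
Let BA t : 'M[F]_(k, m) := iter t (mulmx^~ (encA E)) (encB E).

(** Feeding the i-th unit vector at time 0 and nothing else outputs row i of both sides at time t:
    the coefficients of G are the Markov parameters D, BC, BAC, ... *)
Lemma impulse_response t :
  map_mx (coefp t) G = if t is t'.+1 then BA t' *m encC E else encD E.
Proof.
apply/row_matrixP => i.
pose u (t : int) : 'rV[F]_k := if t == 0 then delta_mx 0 i else 0.
have u0 : vanishes_before 0 u by move=> s; rewrite /u; case: eqP => // ->; rewrite ltxx.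
have state d : enc_state_after E u 0 d.+1 = row i (BA d).
  elim: d => [|d IHd].
    by rewrite /= /enc_next mul0mx add0r rowE.
  rewrite -[LHS]/(enc_next E (enc_state_after E u 0 d.+1) (u (0 + d.+1%:Z))).
  by rewrite IHd /enc_next /u /= mul0mx addr0 row_mul.
transitivity (series_mulmx u G t%:Z).
  apply/rowP => j; rewrite !mxE (bigD1 i) //= big1 => [|h neq_hi]; last first.
    rewrite /series_mul_poly big1 // => l _; rewrite /u.
    by case: ifP => _; rewrite !mxE ?(negPf neq_hi) ?andbF mul0r.
  rewrite addr0 /series_mul_poly.
  under eq_bigr do rewrite /u subr_eq0 eqz_nat.
  have [lt_t|le_t] := ltnP t (size (G i j)).
    rewrite (bigD1 (Ordinal lt_t)) //= eqxx mxE !eqxx mul1r big1 ?addr0 // => l.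
    by rewrite -val_eqE eq_sym /= => /negPf->; rewrite mxE mul0r.
  rewrite nth_default // big1 // => l _; case: eqP => [Et|_]; last by rewrite mxE mul0r.
  by have := leq_trans (ltn_ord l) le_t; rewrite Et ltnn.
rewrite -(realE u0) /enc_output /enc_state subr0 /enc_out.
case: t => [|t]; first by rewrite /u /= mul0mx add0r -rowE.
by rewrite state /u /= mul0mx addr0 row_mul.
Qed.

(* The partial sums V N of B (1 - X A)^-1 give the identity up to an error
   divisible by X^(N + 1), for all large N: the error is 0. *)
Lemma transfer_function : chi *: G = chi *: D + 'X *: (B *m \adj XA *m C).
Proof.
pose V N : 'M[{poly F}]_(k, m) := \sum_(t < N) 'X^t *: map_mx polyC (BA t).
have VXA N : V N *m XA = B - 'X^N *: map_mx polyC (BA N).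
  elim: N => [|N IHN]; first by rewrite /V big_ord0 mul0mx scale1r subrr.
  rewrite /V big_ord_recr /= mulmxDl -/(V N) IHN /XA mulmxBr mulmx1.
  by rewrite -scalemxAr -scalemxAl -map_mxM scalerA -exprS addrA subrK.
(* The omitted terms B A^t C with t >= N are coefficients of G beyond its degree, hence 0. *)
have GV N : (forall i j, size (G i j) <= N)%N -> G = D + 'X *: (V N *m C).
  move=> le_N; apply/matrixP => i j; apply/polyP => t.
  have /matrixP/(_ i j) := impulse_response t; rewrite mxE /= => ->.
  rewrite mxE coefD mxE coefC [('X *: (V N *m C)) i j]mxE coefXM.
  case: t => [|t] /=; first by rewrite addr0.
  rewrite add0r mulmx_suml summxE coef_sum.
  under eq_bigr do rewrite -scalemxAl -map_mxM mxE coefXnM mxE coefC.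
  have [lt_t|le_t] := ltnP t N.
    rewrite (bigD1 (Ordinal lt_t)) //= ltnn subnn eqxx big1 ?addr0 // => s neq_s.
    case: ltnP => // le_s; rewrite subn_eq0 leqNgt ltn_neqAle le_s andbT.
    by rewrite -val_eqE /= in neq_s; rewrite neq_s.
  rewrite big1 => [|s _].
    have /matrixP/(_ i j) := impulse_response t.+1; rewrite mxE /= => <-.
    by rewrite nth_default // (leq_trans (le_N _ _)) // leqW.
  have lt_s := leq_trans (ltn_ord s) le_t.
  by rewrite ltnNge ltnW //= subn_eq0 leqNgt lt_s.
apply/eqP; rewrite -subr_eq0; apply/eqP.
set Z := _ - _; apply/matrixP => i j; rewrite [RHS]mxE.
(* N is large enough for [GV] and for a multiple of X^(N + 1) of the size of [Z i j] to be 0. *)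
pose N := maxn (\max_i \max_j size (G i j))%N (size (Z i j)).
have le_N i' j' : (size (G i' j') <= N)%N.
  by apply/(leq_trans _ (leq_maxl _ _))/(leq_trans _ (leq_bigmax i'))/(leq_bigmax j').
have EZ : Z = - ('X^(N.+1) *: (map_mx polyC (BA N) *m \adj XA *m C)).
  rewrite /Z [in LHS](GV N le_N) scalerDr opprD addrACA subrr add0r.
  rewrite scalerA mulrC -scalerA -scalerBr exprS -scalerA -scalerN.
  congr (_ *: _).
  have -> : chi *: (V N *m C) = V N *m XA *m \adj XA *m C.
    by rewrite -[V N *m XA *m _]mulmxA mul_mx_adj mul_mx_scalar -scalemxAl.
  rewrite VXA mulmxBl mulmxBl.
  by rewrite addrAC subrr add0r -!scalemxAl.
apply/polyP => l; rewrite coef0; have [le_l|lt_l] := ltnP N l.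
  by rewrite nth_default //; apply: leq_trans (leq_maxr _ _) (ltnW le_l).
move: (_ *m \adj XA *m C) EZ => W EZ.
have -> : Z i j = - ('X^(N.+1) * W i j) by rewrite [in LHS]EZ !mxE.
by rewrite coefN coefXnM ltnS lt_l oppr0.
Qed.

Lemma realizes_intdeg_leq : (intdeg G <= m)%N.
Proof.
apply/bigmax_leqP => f _.
pose Cf := colsub f C; pose Df := colsub f D; pose Gf := colsub f G.
pose M := block_mx XA (- Cf) ('X *: B) Df.
have chi_neq0 : chi != 0.
  apply/eqP => /(congr1 (horner_eval 0)); rewrite /chi -det_map_mx.
  rewrite (_ : map_mx _ _ = 1%:M) ?det1 /horner_eval ?horner0.
    by move/eqP; rewrite oner_eq0.
  apply/matrixP => i j; rewrite !mxE /= /horner_eval !hornerE subr0.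
  by case: (i == j); rewrite !hornerE.
have detM : \det M = chi * \det Gf.
  (* Block elimination with the adjugate in place of the inverse stays polynomial; the extra factor
     chi^k appears on both sides and cancels. *)
  have : block_mx 1%:M 0 (- 'X *: (B *m \adj XA)) chi%:M *m M =
      block_mx XA (- Cf) 0 (chi *: Gf).
    rewrite mulmx_block !mul1mx !mul0mx !addr0; congr block_mx.
      rewrite -scalemxAl -mulmxA mul_adj_mx mul_mx_scalar mul_scalar_mx.
      by rewrite -/chi scaleNr !scalerA mulrC addNr.
    have /(congr1 (colsub f)) := transfer_function.
    rewrite mul_scalar_mx mulmxN -scalemxAl scaleNr opprK.
    move=> EG; apply/matrixP => i j; move/matrixP/(_ i j): EG; rewrite !mxE => ->.
    rewrite addrC; congr (_ + 'X * _); apply: eq_bigr => a _; by rewrite !mxE.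
  move/(congr1 determinant); rewrite det_mulmx det_lblock det_ublock det1 mul1r.
  rewrite det_scalar detZ mulrCA; apply: mulfI; exact: expf_neq0.
have size_M : (size (\det M) <= m.+1)%N.
  (* [size_det_leq] bounds by rows, while here the columns have small degree: at most 1 for the
     first m, 0 for the others. *)
  rewrite -det_tr; pose d (i : 'I_(m + k)) : nat := (i < m)%N.
  have sum_d : (\sum_i d i)%N = m.
    rewrite big_split_ord /= (eq_bigr (fun=> 1%N)) => [|i _]; last by rewrite /d /= ltn_ord.
    rewrite [X in (_ + X)%N]big1 => [|i _]; last by rewrite /d /= ltnNge leq_addr.
    by rewrite sum1_card card_ord addn0.
  rewrite -[X in (_ <= X.+1)%N]sum_d; apply: size_det_leq => i j; rewrite mxE /M /d.
  case: (split_ordP i) => a ->; case: (split_ordP j) => b ->.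
  - rewrite block_mxEul !mxE; apply: leq_trans (size_polyD _ _) _.
    rewrite geq_max size_polyN; apply/andP; split.
      by case: (b == a); rewrite ?size_poly1 ?size_poly0.
    by apply: leq_trans (size_polyMleq _ _) _; rewrite size_polyX size_polyC; case: eqP.
  - rewrite block_mxEdl !mxE.
    by apply: leq_trans (size_polyMleq _ _) _; rewrite size_polyX size_polyC; case: eqP.
  - by rewrite block_mxEur !mxE size_polyN; apply: leq_trans (size_polyC_leq1 _) _.
  - by rewrite block_mxEdr !mxE; apply: leq_trans (size_polyC_leq1 _) _.
have [->|Gf_neq0] := eqVneq (\det Gf) 0; first by rewrite size_poly0.
move: size_M; rewrite detM size_mul // => le_m; rewrite -ltnS.
apply: leq_trans le_m.
rewrite -[size chi]prednK ?lt0n ?size_poly_eq0 // addSn /=.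
by apply: leq_trans (leq_addl _ _); rewrite prednK // lt0n size_poly_eq0.
Qed.

End Transfer.

Theorem corollary1 (F : finFieldType) (k n : nat) (hk : (1 <= k)%N)
    (hkn : (k <= n)%N) (G : 'M[{poly F}]_(k, n)) (hG : poly_mxrank G = k) :
  (intdeg G <= Mcdeg G)%N /\
  (reduced G -> intdeg G = Mcdeg G /\ Mcdeg G = extdeg G).
Proof.
have intdeg_le : (intdeg G <= Mcdeg G)%N.
  rewrite /Mcdeg; case: ex_minnP => m /boolp.asboolP[E realE] _.
  exact: realizes_intdeg_leq realE.
split=> // redG; have ext_le := reduced_extdeg_leq_intdeg hG redG.
have Mc_le := Mcdeg_leq_extdeg G.
by split; apply/eqP; rewrite eqn_leq ?intdeg_le ?Mc_le ?(leq_trans Mc_le) //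
  (leq_trans ext_le).
Qed.
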